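(* Let $(B,\underline{\circ},\langle\cdot,\cdot\rangle')$ be a weakly flat pseudo-Riemannian $F$-Lie algebra with Lie bracket $[\cdot,\cdot]_B$ and Levi-Civita product $\underline{\ast}$. Suppose there exist parameters $\mu,\lambda,\beta\in\mathbb{R}$, $a_0,b_0,\overline{e}\in B$, a linear map $u:B\to B$ with $u([x,y]_B)=x\underline{\ast}u(y)-y\underline{\ast}u(x)$ for all $x,y\in B$, a derivation $D$ of the Lie algebra $B$, and a linear map $v:B\to B$ with $v(x\underline{\circ}y)=v(x)\underline{\circ}y$ for all $x,y\in B$, such that $(D-u)^\ast=-(D-u)$, $v^\ast=v$, and the following equations hold for all $x,y,z\in B$: $$[D,u]=u^2-\mu u-R_{b_0},$$ $$x\underline{\ast}u(y)-u(x\underline{\ast}y)=D(x)\underline{\ast}y+x\underline{\ast}D(y)-D(x\underline{\ast}y),$$ $$v^2=\lambda v+r_{a_0},$$ $$-\lambda\mu a_0+\lambda v(b_0)+v((u-u^\ast)(a_0))+v(D(a_0))+\lambda(u-u^\ast)(a_0)-\mathrm{ad}^\ast_{a_0}(a_0)-\lambda^2b_0+\lambda D^\ast(a_0)-2v(D^\ast(a_0))+2D^\ast(v(a_0))=0,$$ $$[\mathrm{ad}_{a_0},v]+\lambda[D,v]+2[v,vD]+r_{D(a_0)}=0,$$ $$\lambda\mu v-r_{(u-u^\ast)(a_0)}-\lambda r_{b_0}+2r_{D^\ast(a_0)}-\lambda D^\ast v-2D^\ast r_{a_0}+\mathrm{ad}^\ast_{a_0}v+v\,\mathrm{ad}_{a_0}-\lambda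 vD-2r_{a_0}D=0,$$ $$[x\underline{\circ}y,a_0]_B-x\underline{\circ}[y,a_0]_B-y\underline{\circ}[x,a_0]_B+(2v-\lambda\,\mathrm{id}_B)\big(D(x\underline{\circ}y)-x\underline{\circ}D(y)-y\underline{\circ}D(x)\big)=0,$$ $$v(u-u^\ast+D-D^\ast)v+\lambda[v,u-u^\ast]+\lambda(D^\ast v-vD)+D^\ast r_{a_0}-r_{a_0}D+\lambda^2(u-u^\ast)+\lambda\widetilde{\mathrm{ad}}_{a_0}-(\widetilde{\mathrm{ad}}_{a_0}v+v\widetilde{\mathrm{ad}}_{a_0})+\widetilde{\mathrm{ad}}_{v(a_0)}=0,$$ $$v\big(v([x,y]_B)-[v(x),y]_B-[v(y),x]_B\big)+v(x\underline{\circ}D(y)-y\underline{\circ}D(x))+D(v(x))\underline{\circ}y-D(v(y))\underline{\circ}x+[v(x),v(y)]_B=0,$$ $$(v-\lambda\,\mathrm{id}_B)((u-u^\ast)(x\underline{\circ}y))+v(D(x\underline{\circ}y)-x\underline{\circ}D(y)-y\underline{\circ}D(x))+(\lambda\,\mathrm{id}_B-v)(\mathrm{ad}_x^\ast(v(y))+\mathrm{ad}_y^\ast(v(x)))-\mathrm{ad}^\ast_{x\underline{\circ}y}(a_0)+\mathrm{ad}^\ast_x(a_0\underline{\circ}y)+\mathrm{ad}^\ast_y(a_0\underline{\circ}x)=0,$$ $$[x\underline{\circ}y,v(z)]_B-x\underline{\circ}[y,v(z)]_B-y\underline{\circ}[x,v(z)]_B+D(x\underline{\circ}y)\underline{\circ}z-(x\underline{\circ}D(y))\underline{\circ}z-(y\underline{\circ}D(x))\underline{\circ}z-v\big([x\underline{\circ}y,z]_B-x\underline{\circ}[y,z]_B-y\underline{\circ}[x,z]_B\big)=0,$$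 $$(u-u^\ast)(x\underline{\circ}y)\underline{\circ}z-v\big([x\underline{\circ}y,z]_B-x\underline{\circ}[y,z]_B-y\underline{\circ}[x,z]_B\big)-\mathrm{ad}^\ast_{x\underline{\circ}y}(v(z))-\mathrm{ad}^\ast_x(v(y))\underline{\circ}z-\mathrm{ad}^\ast_y(v(x))\underline{\circ}z+\mathrm{ad}^\ast_x(y\underline{\circ}v(z))+\mathrm{ad}^\ast_y(x\underline{\circ}v(z))=0.$$ Then the vector space $\mathfrak{g}=\mathbb{R}a\oplus B\oplus\mathbb{R}d$ equipped with: (1) the scalar product $\langle\cdot,\cdot\rangle$ extending $\langle\cdot,\cdot\rangle'$ for which $\mathbb{R}a\oplus\mathbb{R}d$ is a hyperbolic plane ($\langle a,a\rangle=\langle d,d\rangle=0$, $\langle a,d\rangle=1$) orthogonal to $B$; (2) the Levi-Civita product $\ast$ given, for $x,y\in B$, by $a\ast a=a\ast x=x\ast a=a\ast d=0$, $x\ast y=\langle u(x),y\rangle'a+x\underline{\ast}y$, $d\ast a=\mu a$, $d\ast d=b_0-\mu d$, $d\ast x=-\langle b_0,x\rangle'a+(D-u)(x)$, $x\ast d=-u(x)$ (with Lie bracket $[p,q]=p\ast q-q\ast p$); (3) the associative commutative product $\circ$ given, for $x,y\in B$, by $a\circ a=a\circ x=x\circ a=0$, $x\circ y=\langle v(x),y\rangle'a+x\underline{\circ}y$, $a\circ d=\lambda a$, $d\circ d=\beta a+a_0+\lambda d$, $d\circ x=\langle a_0,x\rangle'a+v(x)$; is a weakly flat pseudo-Riemannian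 $F$-Lie algebra. Furthermore, if ($\lambda\neq 0$ and) the additional equations $$v(\overline{e})=-\tfrac1\lambda a_0,\quad r_{\overline{e}}+\tfrac1\lambda v=\mathrm{id}_B,\quad (D-u)(\overline{e})=-\tfrac1\lambda b_0,\quad R_{\overline{e}}-\tfrac1\lambda u=0$$ hold, implying $\mu=0$, then $\mathfrak{g}$ becomes a flat pseudo-Riemannian $F$-Lie algebra with flat unit element $$e=-\Big(\frac{\langle a_0,\overline{e}\rangle'}{\lambda}+\frac{\beta}{\lambda^2}\Big)a+\overline{e}+\frac1\lambda d.$$
   Context: All Lie algebras and vector spaces are real and finite-dimensional. A scalar product is a non-degenerate symmetric bilinear form (any signature). For a Lie algebra $\mathfrak{g}$ with scalar product $\langle\cdot,\cdot\rangle$, the Levi-Civita product $\ast$ is the unique bilinear product with $2\langle x\ast y,z\rangle=\langle[x,y],z\rangle-\langle[y,z],x\rangle+\langle[z,x],y\rangle$; it satisfies $[x,y]=x\ast y-y\ast x$ and $\langle x\ast y,z\rangle+\langle y,x\ast z\rangle=0$. The scalar product is flat if $\ast$ is left-symmetric: $(x\ast y)\ast z-x\ast(y\ast z)=(y\ast x)\ast z-y\ast(x\ast z)$. A weakly flat pseudo-Riemannian $F$-Lie algebra $(\mathfrak{g},\circ,\langle\cdot,\cdot\rangle)$ is a Lie algebra $\mathfrak{g}$ with a flat scalar product and an associative commutative bilinear product $\circ$ (no unit, or no flatness of the unit, required) satisfying the Frobenius identity $\langle x\circ y,z\rangle=\langle x,y\circ z\rangle$ and the Hertling-Manin relation, for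 all $x,y,z,w$: $$[x\circ y,z\circ w]-[x\circ y,z]\circ w-[x\circ y,w]\circ z-x\circ[y,z\circ w]+x\circ[y,z]\circ w+x\circ[y,w]\circ z-y\circ[x,z\circ w]+y\circ[x,z]\circ w+y\circ[x,w]\circ z=0.$$ It is a flat pseudo-Riemannian $F$-Lie algebra $(\mathfrak{g},\circ,\langle\cdot,\cdot\rangle,e)$ if moreover $e\in\mathfrak{g}$ is a unit for $\circ$ and is flat: $x\ast e=0$ for all $x\in\mathfrak{g}$. Notation on $B$: for a linear map $s:B\to B$, $s^\ast$ is its adjoint with respect to $\langle\cdot,\cdot\rangle'$; for $s\in B$, $R_s(x)=x\underline{\ast}s$; $r_s(x)=x\underline{\circ}s$; $\mathrm{ad}_s(x)=[s,x]_B$, with adjoint $\mathrm{ad}_s^\ast$; $\widetilde{\mathrm{ad}}_s(x)=\mathrm{ad}_x^\ast(s)$. Brackets of linear maps are commutators, juxtaposition is composition.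
   Formalization: Printed signs fail by counterexample; proved with -λ(u-u* )(a0) for +λ(u-u* )(a0), -λ(v(u-u* )+(u-u* )v) for λ[v,u-u*], and +[v(y),x] for -[v(y),x]. ''Implying μ=0'' fails when v=0; proved: v≠0 gives μ=0, and μ=0 gives the flat unit. *)

(* Defs.v *)
From HB Require Import structures.
From mathcomp Require Import all_boot all_order all_algebra reals ring.

Set Implicit Arguments.
Unset Strict Implicit.
Unset Printing Implicit Defensive.

Import Order.TTheory GRing.Theory Num.Theory.

Local Open Scope ring_scope.

Section ScalarProduct.
Variables (R : realType) (V : vectType R).
Implicit Types (g : V -> V -> R) (br circ : V -> V -> V).

Definition bilinear_product (p : V -> V -> V) : Prop :=
  bilinear_for *:%R *:%R p.

Record scalar_product g : Prop := ScalarProduct {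
  scalar_product_bilinear : bilinear_for *%R *%R g;
  scalar_product_sym : forall x y, g x y = g y x;
  scalar_product_nondegenerate : forall x, (forall y, g x y = 0) -> x = 0
}.

(* The vector representing the linear form f through g, see riesz_spec: the
   inverse image of f under the isomorphism x |-> g x - from V to its dual. *)
Definition riesz g (f : V -> R) : V :=
  ((linfun (fun x => linfun (g x : V -> R^o) : 'Hom(V, R^o)))^-1)%VF
    (linfun (f : V -> R^o)).

Lemma riesz_spec g (f : V -> R) :
  scalar_product g -> scalar f -> forall z, g (riesz g f) z = f z.
Proof.
case=> [[gl gr] _ gnd] fl.
have linE (h : V -> R^o) : linear h -> linfun h =1 h.
  move=> hl x.
  pose hL : {linear V -> R^o} := HB.pack h (GRing.isLinear.Build _ _ _ _ _ hl).
  exact: (lfunE hL x).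
pose G := fun x => linfun (g x : V -> R^o) : 'Hom(V, R^o).
have GE x y : G x y = g x y by rewrite linE // => ? ? ?; apply: gr.
have Gl : linear G.
  by move=> c x y; apply/lfunP=> z; rewrite !lfunE /= !lfunE /= !GE gl.
pose GL : {linear V -> 'Hom(V, R^o)} :=
  HB.pack G (GRing.isLinear.Build _ _ _ _ _ Gl).
have ker0 : lker (linfun GL) == 0%VS.
  apply/lker0P => x y; rewrite !lfunE /= => Gxy.
  apply/eqP; rewrite -subr_eq0; apply/eqP/gnd => z.
  by rewrite addrC -scaleN1r gl -!GE Gxy /= mulN1r addNr.
have imgT : limg (linfun GL) = fullv.
  apply/eqP; rewrite -(dimv_leqif_eq (subvf _)).2.
  by rewrite limg_dim_eq ?(eqP ker0) ?capv0 // !dimvf /dim /= muln1.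
move=> z.
have := limg_lfunVK (f := linfun GL) (x := linfun (f : V -> R^o)).
rewrite imgT memvf => /(_ isT) /lfunP /(_ z).
by rewrite lfunE /= GE linE.
Qed.

Definition adjoint g (s : V -> V) (y : V) : V := riesz g (fun x => g (s x) y).

Lemma adjoint_spec g (s : 'End(V)) : scalar_product g ->
  forall x y, g (adjoint g s x) y = g x (s y).
Proof.
move=> gP x y; have [[gl gr] gs _] := gP.
rewrite /adjoint riesz_spec ?(gs x) // => c a b.
by rewrite linearP gl.
Qed.

Record lie_bracket br : Prop := LieBracket {
  lie_bilinear : bilinear_product br;
  lie_alternating : forall x, br x x = 0;
  lie_jacobi : forall x y z,
    br x (br y z) + br y (br z x) + br z (br x y) = 0
}.

Definition levi_civita br g (x y : V) : V :=
  riesz g (fun z => 2^-1 * (g (br x y) z - g (br y z) x + g (br z x) y)).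

Lemma levi_civita_koszul br g : bilinear_product br -> scalar_product g ->
  forall x y z, 2 * g (levi_civita br g x y) z =
    g (br x y) z - g (br y z) x + g (br z x) y.
Proof.
move=> [bl br_] gP x y z; have [[gl gr] gs _] := gP.
rewrite /levi_civita riesz_spec // => [|c a b].
  by rewrite mulrA divff ?mul1r // pnatr_eq0.
by rewrite gr bl br_ !gl /=; ring.
Qed.

Definition left_symmetric (p : V -> V -> V) : Prop := forall x y z,
  p (p x y) z - p x (p y z) = p (p y x) z - p y (p x z).

Definition flat_scalar_product br g : Prop := left_symmetric (levi_civita br g).

Definition hertling_manin br circ : Prop := forall x y z w,
  br (circ x y) (circ z w)
  - circ (br (circ x y) z) w - circ (br (circ x y) w) z
  - circ x (br y (circ z w)) + circ (circ x (br y z)) w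
  + circ (circ x (br y w)) z
  - circ y (br x (circ z w)) + circ (circ y (br x z)) w
  + circ (circ y (br x w)) z = 0.

Record weakly_flat_F_lie br circ g : Prop := WeaklyFlatFLie {
  wF_lie : lie_bracket br;
  wF_scalar : scalar_product g;
  wF_flat : flat_scalar_product br g;
  wF_bilinear : bilinear_product circ;
  wF_assoc : associative circ;
  wF_comm : commutative circ;
  wF_frobenius : forall x y z, g (circ x y) z = g x (circ y z);
  wF_hertling_manin : hertling_manin br circ
}.

Record flat_F_lie br circ g (e : V) : Prop := FlatFLie {
  F_weakly_flat : weakly_flat_F_lie br circ g;
  F_unit : forall x, circ e x = x;
  F_flat_unit : forall x, levi_civita br g x e = 0
}.

End ScalarProduct.

Section DoubleExtension.
Variables (R : realType) (B : vectType R).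
Variables (br circ : B -> B -> B) (g : B -> B -> R).
Variables (mu lambda beta : R) (a0 b0 ebar : B) (u D v : 'End(B)).

Local Notation "x '\star' y" := (levi_civita br g x y)
  (at level 40, left associativity).
Local Notation "x '\circ' y" := (circ x y) (at level 40, left associativity).
Local Notation "[[ x , y ]]" := (br x y) (at level 0).
Local Notation "s ^adj" := (adjoint g s).
Local Notation w x := (u x%R - u^adj x%R).
(* ad^* s is the adjoint of ad_s, and tad s is x |-> ad_x^* (s) *)
Local Notation "'ad^*' s" := (adjoint g (br s)) (at level 10, s at level 8).
Local Notation tad s x := (ad^* x s).

(* Operator identities are evaluated at a vector x; R_s x = x \star s and
   r_s x = x \circ s.
   The signs of lambda *: w a0 in ext_a0, of lambda *: (v (w x) + w (v x)) in
   ext_skew and of [[v y, x]] in ext_v_bracket are those produced by the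
   Hertling-Manin relation of the extension on (x, d, d, d) and (x, d, y, d).
   With + lambda *: w a0, with + lambda *: (v (w x) - w (v x)), or with
   - [[v y, x]] instead, that relation can fail. *)
Record double_extension_data : Prop := DoubleExtensionData {
  ext_u_cocycle : forall x y, u [[x, y]] = x \star u y - y \star u x;
  ext_D_derivation : forall x y, D [[x, y]] = [[D x, y]] + [[x, D y]];
  ext_v_module : forall x y, v (x \circ y) = v x \circ y;
  ext_Du_skew : forall x, (D - u)^adj x = - (D - u) x;
  ext_v_selfadj : forall x, v^adj x = v x;
  ext_Du_comm : forall x, D (u x) - u (D x) = u (u x) - mu *: u x - x \star b0;
  ext_Du_star : forall x y,
    x \star u y - u (x \star y) = D x \star y + x \star D y - D (x \star y);
  ext_v_square : forall x, v (v x) = lambda *: v x + x \circ a0;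
  ext_a0 :
    - (lambda * mu) *: a0 + lambda *: v b0 + v (w a0) + v (D a0)
    - lambda *: w a0 - ad^* a0 a0 - lambda ^+ 2 *: b0 + lambda *: D^adj a0
    - 2 *: v (D^adj a0) + 2 *: D^adj (v a0) = 0;
  ext_ad_v : forall x,
    ([[a0, v x]] - v [[a0, x]]) + lambda *: (D (v x) - v (D x))
    + 2 *: (v (v (D x)) - v (D (v x))) + x \circ D a0 = 0;
  ext_v_D : forall x,
    (lambda * mu) *: v x - x \circ w a0 - lambda *: (x \circ b0)
    + 2 *: (x \circ D^adj a0) - lambda *: D^adj (v x) - 2 *: D^adj (x \circ a0)
    + ad^* a0 (v x) + v [[a0, x]] - lambda *: v (D x)
    - 2 *: (D x \circ a0) = 0;
  ext_a0_circ : forall x y,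
    [[x \circ y, a0]] - x \circ [[y, a0]] - y \circ [[x, a0]]
    + (2 *: v (D (x \circ y) - x \circ D y - y \circ D x)
       - lambda *: (D (x \circ y) - x \circ D y - y \circ D x)) = 0;
  ext_skew : forall x,
    v (w (v x) + D (v x) - D^adj (v x)) - lambda *: (v (w x) + w (v x))
    + lambda *: (D^adj (v x) - v (D x)) + D^adj (x \circ a0) - D x \circ a0
    + lambda ^+ 2 *: w x + lambda *: tad a0 x
    - (tad a0 (v x) + v (tad a0 x)) + tad (v a0) x = 0;
  ext_v_bracket : forall x y,
    v (v [[x, y]] - [[v x, y]] + [[v y, x]])
    + v (x \circ D y - y \circ D x)
    + D (v x) \circ y - D (v y) \circ x + [[v x, v y]] = 0;
  ext_w_circ : forall x y,
    (v (w (x \circ y)) - lambda *: w (x \circ y))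
    + v (D (x \circ y) - x \circ D y - y \circ D x)
    + (lambda *: (ad^* x (v y) + ad^* y (v x))
       - v (ad^* x (v y) + ad^* y (v x)))
    - ad^* (x \circ y) a0 + ad^* x (a0 \circ y) + ad^* y (a0 \circ x) = 0;
  ext_circ_v : forall x y z,
    [[x \circ y, v z]] - x \circ [[y, v z]] - y \circ [[x, v z]]
    + D (x \circ y) \circ z - (x \circ D y) \circ z - (y \circ D x) \circ z
    - v ([[x \circ y, z]] - x \circ [[y, z]] - y \circ [[x, z]]) = 0;
  ext_w_circ_circ : forall x y z,
    w (x \circ y) \circ z
    - v ([[x \circ y, z]] - x \circ [[y, z]] - y \circ [[x, z]])
    - ad^* (x \circ y) (v z) - ad^* x (v y) \circ z - ad^* y (v x) \circ z
    + ad^* x (y \circ v z) + ad^* y (x \circ v z) = 0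
}.

(* Together with double_extension_data these force mu = 0 as soon as v <> 0.
   If v = 0 they need not: take for B the line spanned by a unit ebar for circ,
   with u = D = v = 0, a0 = b0 = 0 and lambda = 1; then mu is arbitrary, and
   d * ext_unit has d-component - mu / lambda. *)
Record unit_data : Prop := UnitData {
  unit_lambda : lambda != 0;
  unit_v : v ebar = - lambda^-1 *: a0;
  unit_circ : forall x, x \circ ebar + lambda^-1 *: v x = x;
  unit_Du : (D - u) ebar = - lambda^-1 *: b0;
  unit_star : forall x, x \star ebar - lambda^-1 *: u x = 0
}.

End DoubleExtension.

Section ExtendedStructure.
Variables (R : realType) (B : vectType R).
Variables (star circ : B -> B -> B) (g : B -> B -> R).
Variables (mu lambda beta : R) (a0 b0 ebar : B) (u D v : 'End(B)).
Local Notation gT := (R^o * B * R^o)%type.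

(* (al, x, de) : gT stands for al a + x + de d; the operations below are the
   bilinear ones with the values on a, d and B listed in the *_table lemmas. *)
Definition ext_form (p q : gT) : R :=
  let: (al, x, de) := p in let: (al', y, de') := q in
  al * de' + g x y + de * al'.

Definition ext_star (p q : gT) : gT :=
  let: (al, x, de) := p in let: (al', y, de') := q in
  (g (u x) y + mu * de * al' - de * g b0 y,
   star x y - de' *: u x + (de * de') *: b0 + de *: (D - u) y,
   - (mu * de * de')).

Definition ext_bracket (p q : gT) : gT := ext_star p q - ext_star q p.

Definition ext_circ (p q : gT) : gT :=
  let: (al, x, de) := p in let: (al', y, de') := q in
  (g (v x) y + lambda * (al * de' + de * al') + beta * de * de'
     + de * g a0 y + de' * g a0 x,
   circ x y + (de * de') *: a0 + de *: v y + de' *: v x,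
   lambda * de * de').

Definition ext_unit : gT :=
  (- (g a0 ebar / lambda + beta / lambda ^+ 2), ebar, lambda^-1).

Let a : gT := (1, 0, 0).
Let d : gT := (0, 0, 1).
Let i (x : B) : gT := (0, x, 0).

Lemma scalar2_0 (f : B -> B -> R) : bilinear_for *%R *%R f ->
  (forall y, f 0 y = 0) /\ (forall x, f x 0 = 0).
Proof.
case=> fl fr; split=> z.
  by have /= := fl z (-1) 0 0; rewrite scaler0 addr0 mulN1r addNr.
by have /= := fr z (-1) 0 0; rewrite scaler0 addr0 mulN1r addNr.
Qed.

Lemma product_0 (p : B -> B -> B) : bilinear_product p ->
  (forall y, p 0 y = 0) /\ (forall x, p x 0 = 0).
Proof.
case=> pl pr; split=> z.
  by have /= := pl z (-1) 0 0; rewrite scaler0 addr0 scaleN1r addNr.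
by have /= := pr z (-1) 0 0; rewrite scaler0 addr0 scaleN1r addNr.
Qed.

Let gT_eq (p q : gT) : p.1.1 = q.1.1 -> p.1.2 = q.1.2 -> p.2 = q.2 -> p = q.
Proof. by case: p q => [[? ?] ?] [[? ?] ?] /= -> -> ->. Qed.

Let alg1 (c : R) : c *: (1 : R^o) = c. Proof. exact: mulr1. Qed.

Let simpE := (linear0, scaler0, scale0r, scale1r, mulr0, mul0r, mulr1, mul1r,
  addr0, add0r, subr0, sub0r, oppr0).

Lemma ext_form_table : bilinear_for *%R *%R g -> forall x y,
  [/\ [/\ ext_form a a = 0, ext_form d d = 0, ext_form a d = 1
       & ext_form d a = 1],
      ext_form a (i x) = 0 /\ ext_form (i x) a = 0,
      ext_form d (i x) = 0 /\ ext_form (i x) d = 0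
    & ext_form (i x) (i y) = g x y].
Proof.
move=> /scalar2_0[g0l g0r] x y.
have zE := (g0l, g0r).
by rewrite /ext_form /a /d /i; do ![split]; do ?[apply: gT_eq => /=];
  rewrite ?(zE, simpE) ?alg1.
Qed.

Lemma ext_star_table : bilinear_for *%R *%R g -> bilinear_product star ->
  forall x y,
  [/\ [/\ ext_star a a = 0, ext_star a (i x) = 0, ext_star (i x) a = 0
        & ext_star a d = 0],
      ext_star (i x) (i y) = g (u x) y *: a + i (star x y),
      ext_star d a = mu *: a /\ ext_star d d = i b0 - mu *: d,
      ext_star d (i x) = - g b0 x *: a + i ((D - u) x)
    & ext_star (i x) d = - i (u x)].
Proof.
move=> /scalar2_0[g0l g0r] /product_0[s0l s0r] x y.
have zE := (g0l, g0r, s0l, s0r).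
by rewrite /ext_star /a /d /i; do ![split]; do ?[apply: gT_eq => /=];
  rewrite ?(zE, simpE) ?alg1.
Qed.

Lemma ext_circ_table : bilinear_for *%R *%R g -> bilinear_product circ ->
  forall x y,
  [/\ [/\ ext_circ a a = 0, ext_circ a (i x) = 0 & ext_circ (i x) a = 0],
      ext_circ (i x) (i y) = g (v x) y *: a + i (circ x y),
      ext_circ a d = lambda *: a /\ ext_circ d a = lambda *: a,
      ext_circ d d = beta *: a + i a0 + lambda *: d
    & ext_circ d (i x) = g a0 x *: a + i (v x)
      /\ ext_circ (i x) d = g a0 x *: a + i (v x)].
Proof.
move=> /scalar2_0[g0l g0r] /product_0[c0l c0r] x y.
have zE := (g0l, g0r, c0l, c0r).
by rewrite /ext_circ /a /d /i; do ![split]; do ?[apply: gT_eq => /=];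
  rewrite ?(zE, simpE) ?alg1.
Qed.

End ExtendedStructure.

(* Main.v *)
Require Import Defs.
From mathcomp Require Import all_boot all_order all_algebra reals ring lra.

(* The product * on g is metric and has the bracket as commutator, so it is the
   Levi-Civita product by uniqueness; its left symmetry splits into the
   conditions on u and D, and gives the Jacobi identity.

   The left-hand side of the Hertling-Manin relation is linear in each argument,
   symmetric in (x, y) and in (z, w), and antisymmetric under exchange of these
   two pairs.  With a^perp = Ra + B it is therefore enough to evaluate it at
   (x, y, z, t), (x, y, z, d), (x, y, d, d), (x, d, y, d) and (x, d, d, d) with
   x, y, z, t in a^perp.  Each value lies in a^perp: its B-component is one
   hypothesis, its a-component another one paired with the last vector of B.

   For mu: the form S(p, q) = <p * e, q> + <q * e, p> satisfies
   S(p o q, r) = S(p, q o r), as ad_e is a derivation of o.  Here p * e = 0 on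
   a^perp, and comparing S(d o x, y) with S(d, x o y) gives mu <v x, y> = 0. *)

Set Implicit Arguments.
Unset Strict Implicit.
Unset Printing Implicit Defensive.

Import Order.TTheory GRing.Theory Num.Theory.

Local Open Scope ring_scope.

(** * Rewriting rules for bilinear maps and forms *)

Section Bilinear.
Variables (R : realType) (U U' V : lmodType R) (f : U -> U' -> V).
Hypothesis fP : bilinear_for *:%R *:%R f.

Lemma bilinDl x y z : f (x + y) z = f x z + f y z.
Proof. by have /= := fP.1 z 1 x y; rewrite !scale1r. Qed.

Lemma bilinDr x y z : f z (x + y) = f z x + f z y.
Proof. by have /= := fP.2 z 1 x y; rewrite !scale1r. Qed.

Lemma bilin0l z : f 0 z = 0.
Proof. by apply: (addrI (f 0 z)); rewrite -bilinDl !addr0. Qed.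

Lemma bilin0r z : f z 0 = 0.
Proof. by apply: (addrI (f z 0)); rewrite -bilinDr !addr0. Qed.

Lemma bilinZl c x z : f (c *: x) z = c *: f x z.
Proof. by have /= := fP.1 z c x 0; rewrite bilin0l !addr0. Qed.

Lemma bilinZr c x z : f z (c *: x) = c *: f z x.
Proof. by have /= := fP.2 z c x 0; rewrite bilin0r !addr0. Qed.

Lemma bilinNl x z : f (- x) z = - f x z.
Proof. by rewrite -scaleN1r bilinZl scaleN1r. Qed.

Lemma bilinNr x z : f z (- x) = - f z x.
Proof. by rewrite -scaleN1r bilinZr scaleN1r. Qed.

Definition bilinE := ((bilinDl, bilinDr, bilin0l, bilin0r),
  (bilinZl, bilinZr, bilinNl, bilinNr)).

End Bilinear.

Section Form.
Variables (R : realType) (V : lmodType R) (g : V -> V -> R).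
Hypothesis gP : bilinear_for *%R *%R g.
(** Scaling in [R^o] is multiplication by conversion, so a form is a bilinear map into [R^o]. *)
Let gP' : bilinear_for (V := R^o) *:%R *:%R g := gP.

Lemma formDl x y z : g (x + y) z = g x z + g y z.
Proof. exact: (bilinDl gP'). Qed.
Lemma formDr x y z : g z (x + y) = g z x + g z y.
Proof. exact: (bilinDr gP'). Qed.
Lemma form0l z : g 0 z = 0. Proof. exact: (bilin0l gP'). Qed.
Lemma form0r z : g z 0 = 0. Proof. exact: (bilin0r gP'). Qed.
Lemma formZl c x z : g (c *: x) z = c * g x z.
Proof. exact: (bilinZl gP'). Qed.
Lemma formZr c x z : g z (c *: x) = c * g z x.
Proof. exact: (bilinZr gP'). Qed.
Lemma formNl x z : g (- x) z = - g x z. Proof. exact: (bilinNl gP'). Qed.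
Lemma formNr x z : g z (- x) = - g z x. Proof. exact: (bilinNr gP'). Qed.

Definition formE := ((formDl, formDr, form0l, form0r),
  (formZl, formZr, formNl, formNr)).

End Form.

(** * Separation by scalar forms; Lie algebras of left-symmetric products *)

Section Separation.
Variables (R : realType) (V : vectType R).

(** Coordinates in a basis are scalar forms. This turns vector identities into scalar ones, within
    reach of [ring] and [lra]. *)
Lemma eq_scalar (x y : V) : (forall f : {scalar V}, f x = f y) -> x = y.
Proof.
move=> xy; rewrite (coord_vbasis (memvf x)) (coord_vbasis (memvf y)).
by apply: eq_bigr => i _; rewrite xy.
Qed.

Variable p : V -> V -> V.
Hypothesis pb : bilinear_product p.

(** Left symmetry says that left multiplication by a commutator is the commutator of left
    multiplications; its three cyclic instances add up to Jacobi. *)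
Lemma left_symmetric_lie :
  left_symmetric p -> lie_bracket (fun x y => p x y - p y x).
Proof.
have pE := bilinE pb.
move=> ps; split.
- by split=> z c x y /=; apply: eq_scalar => f;
    rewrite !pE !(linearD, linearN, linearZ) /=; ring.
- by move=> x; rewrite subrr.
- move=> x y z; apply: eq_scalar => f;
  rewrite !pE !(linearD, linearN, linear0) /=.
  have := congr1 f (ps x y z); have := congr1 f (ps y z x).
  have := congr1 f (ps z x y); rewrite !linearB => e1 e2 e3.
  lra.
Qed.
End Separation.

(** * The Levi-Civita product *)

Section ScalarProductTheory.
Variables (R : realType) (V : vectType R) (g : V -> V -> R).
Hypothesis gP : scalar_product g.
Let gb := scalar_product_bilinear gP.
Let gC := scalar_product_sym gP.
Let gE := formE gb.

Lemma scalar_product_inj x y : (forall t, g x t = g y t) -> x = y.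
Proof.
move=> xy; apply/eqP; rewrite -subr_eq0; apply/eqP.
by apply: (scalar_product_nondegenerate gP) => t; rewrite !gE xy subrr.
Qed.

Lemma adjoint_linear (s : V -> V) : linear s ->
  forall x y, g (adjoint g s x) y = g x (s y).
Proof.
move=> sl x y; rewrite /adjoint riesz_spec ?(gC x) // => c a b.
by rewrite sl !gE.
Qed.

Variable br : V -> V -> V.
Hypothesis brP : lie_bracket br.
Let brb := lie_bilinear brP.
Let brE := bilinE brb.

Lemma lie_anticomm x y : br x y = - br y x.
Proof.
have := lie_alternating brP (x + y).
rewrite !brE !(lie_alternating brP) add0r addr0.
by move/eqP; rewrite addr_eq0 => /eqP.
Qed.

Let lcE := levi_civita_koszul brb gP.
Let two_inj : injective ( *%R (2 : R)).
Proof. by apply: mulfI; rewrite pnatr_eq0. Qed.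

Lemma levi_civita_bilinear : bilinear_product (levi_civita br g).
Proof.
by split=> z c x y /=; apply: scalar_product_inj => t; apply: two_inj;
  rewrite !gE mulrDr (mulrCA 2 c) !lcE !brE !gE; ring.
Qed.

Lemma levi_civita_skew x y z :
  g (levi_civita br g x y) z = - g y (levi_civita br g x z).
Proof.
apply: two_inj; rewrite mulrN (gC y) !lcE (lie_anticomm y x) (lie_anticomm z x).
by rewrite (lie_anticomm z y) !gE; ring.
Qed.

Lemma levi_civita_torsion x y :
  br x y = levi_civita br g x y - levi_civita br g y x.
Proof.
apply: scalar_product_inj => t; apply: two_inj.
rewrite !gE mulrDr mulrN !lcE (lie_anticomm y x) (lie_anticomm t x).
by rewrite (lie_anticomm t y) !gE; ring.
Qed.

(** Writing the brackets of the Koszul formula through [p] gives six terms; by skewness four cancel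
    in pairs and two equal [g (p x y) z]. *)
Lemma levi_civita_unique (p : V -> V -> V) :
  (forall x y z, g (p x y) z = - g y (p x z)) ->
  (forall x y, br x y = p x y - p y x) -> levi_civita br g =2 p.
Proof.
move=> p_skew p_tor x y; apply: scalar_product_inj => t; apply: two_inj.
rewrite lcE !p_tor !gE (p_skew x t y) (p_skew y x t) (p_skew t y x).
by rewrite (gC x (p y t)) (gC y (p t x)) (gC t (p x y)); ring.
Qed.

End ScalarProductTheory.

(** * Symmetries of the Hertling-Manin relation and its reduction to generators *)

Section HertlingManin.
Variables (R : realType) (V : vectType R) (br circ : V -> V -> V).
Hypotheses (brP : lie_bracket br) (circb : bilinear_product circ).
Hypothesis circC : commutative circ.
Let brE := bilinE (lie_bilinear brP).
Let circE := bilinE circb.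

Definition hm_defect x y z w : V :=
  br (circ x y) (circ z w)
  - circ (br (circ x y) z) w - circ (br (circ x y) w) z
  - circ x (br y (circ z w)) + circ (circ x (br y z)) w
  + circ (circ x (br y w)) z
  - circ y (br x (circ z w)) + circ (circ y (br x z)) w
  + circ (circ y (br x w)) z.

Lemma hm_defectC x y z w : hm_defect x y z w = hm_defect y x z w.
Proof.
by apply: eq_scalar => f; rewrite /hm_defect (circC y x) !linearE /=; ring.
Qed.

Lemma hm_defectCr x y z w : hm_defect x y z w = hm_defect x y w z.
Proof.
by apply: eq_scalar => f; rewrite /hm_defect (circC w z) !linearE /=; ring.
Qed.

Hypothesis circA : associative circ.

(** Reversing every bracket matches the terms pairwise, a bracket with a product going to one of the
    same shape; associativity serves for the products of three factors. *)
Lemma hm_defect_swap x y z w : hm_defect z w x y = - hm_defect x y z w.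
Proof.
have brC := lie_anticomm brP.
apply: eq_scalar => f; rewrite /hm_defect.
rewrite (brC (circ z w) (circ x y)) (brC (circ z w) x) (brC (circ z w) y).
rewrite (brC w (circ x y)) (brC z (circ x y)) (brC w x) (brC z x).
have circCA p q r : circ (circ p q) r = circ (circ r q) p.
  by rewrite circC (circC p) circA.
rewrite (brC w y) (brC z y) !circE (circC (br x (circ z w)) y).
rewrite (circC (br y (circ z w)) x) (circC z (br (circ x y) w)).
rewrite (circC w (br (circ x y) z)) (circCA z _ y) (circCA z _ x).
by rewrite (circCA w _ y) (circCA w _ x) !linearE /=; ring.
Qed.

Lemma hm_defect_linear c p q y z w :
  hm_defect (c *: p + q) y z w = c *: hm_defect p y z w + hm_defect q y z w.
Proof.
apply: eq_scalar => f; rewrite /hm_defect !(brE, circE).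
by rewrite !(linearD, linearN, linearZ) /=; ring.
Qed.

Lemma hertling_manin_of_hyperplane (P : V -> Prop) (d : V) :
  (forall x, exists c : R, P (x - c *: d)) ->
  (forall x y z w, P x -> P y -> P z -> P w -> hm_defect x y z w = 0) ->
  (forall x y z, P x -> P y -> P z -> hm_defect x y z d = 0) ->
  (forall x y, P x -> P y -> hm_defect x y d d = 0) ->
  (forall x y, P x -> P y -> hm_defect x d y d = 0) ->
  (forall x, P x -> hm_defect x d d d = 0) ->
  hertling_manin br circ.
Proof.
move=> Pd h4 h3 h2 h11 h1.
pose G x := P x \/ x = d.
have swap x y z w : hm_defect x y z w = 0 -> hm_defect z w x y = 0.
  by move=> h; rewrite hm_defect_swap h oppr0.
(* The swap makes this value its own opposite. *)
have h0 : hm_defect d d d d = 0.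
  apply: eq_scalar => f; have := congr1 f (hm_defect_swap d d d d).
  by rewrite linearN linear0; lra.
have G4 x y z w : G x -> G y -> G z -> G w -> hm_defect x y z w = 0.
  have G3 p q r t : P p -> G q -> G r -> G t -> hm_defect p q r t = 0.
    move=> Pp [Pq|->] [Pr|->] [Pt|->].
    - exact: (h4 _ _ _ _ Pp Pq Pr Pt).
    - exact: (h3 _ _ _ Pp Pq Pr).
    - by rewrite hm_defectCr (h3 _ _ _ Pp Pq Pt).
    - exact: (h2 _ _ Pp Pq).
    - exact: (swap _ _ _ _ (h3 _ _ _ Pr Pt Pp)).
    - exact: (h11 _ _ Pp Pr).
    - by rewrite hm_defectCr (h11 _ _ Pp Pt).
    - exact: (h1 _ Pp).
  case=> [|->]; first exact: G3.
  case=> [Py|->] Gz Gw; first by rewrite hm_defectC; apply: G3 => //; right.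
  case: Gz => [Pz|->]; first by apply: swap; apply: G3 => //; right.
  case: Gw => [Pw|->] //.
  by rewrite hm_defectCr; apply: swap; apply: G3 => //; right.
(* Linearity is available in the first slot only; the symmetries and the swap bring the other
   arguments there in turn. *)
have ext y z w : (forall x, G x -> hm_defect x y z w = 0) ->
    forall x, hm_defect x y z w = 0.
  move=> hG x; have [c Pc] := Pd x.
  rewrite -[x](subrK (c *: d)) addrC hm_defect_linear.
  by rewrite !hG ?scaler0 ?addr0 //; [left|right].
have ext2 z w : G z -> G w -> forall x y, hm_defect x y z w = 0.
  move=> Gz Gw x y; apply: (ext y) => x' Gx; rewrite hm_defectC.
  by apply: (ext x') => y' Gy; apply: G4.
move=> x y z w; apply: (swap _ _ x y); apply: (ext w) => z' Gz.
rewrite hm_defectC; apply: (ext z') => w' Gw.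
by apply: swap; apply: ext2.
Qed.

End HertlingManin.

(* The Hertling-Manin relation at (e, e, z, w) makes ad_e a derivation of circ;
   as left multiplication by e is skew, the symmetric part of ad_e is, up to
   sign, that of p |-> p * e, and a derivation of a Frobenius product has
   symmetric part compatible with the product. *)
Lemma weakly_flat_unit_symmetric (R : realType) (V : vectType R)
    (br circ : V -> V -> V) (g : V -> V -> R) (e : V) :
  weakly_flat_F_lie br circ g -> (forall x, circ e x = x) ->
  forall p q r,
  g (levi_civita br g (circ p q) e) r + g (levi_civita br g r e) (circ p q) =
  g (levi_civita br g p e) (circ q r) + g (levi_civita br g (circ q r) e) p.
Proof.
case=> brP gP _ circb circA circC frob hm e1.
have gE := formE (scalar_product_bilinear gP).
have gC := scalar_product_sym gP.
have adeD z w : br e (circ z w) = circ (br e z) w + circ z (br e w).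
  apply: eq_scalar => f; have := congr1 f (hm e e z w).
  by rewrite !e1 (circC (br e w)) !(linearD, linearN, linear0) /=; lra.
have symE p q : g (levi_civita br g p e) q + g (levi_civita br g q e) p =
    - (g (br e p) q + g p (br e q)).
  rewrite !(levi_civita_torsion gP brP e) !gE (levi_civita_skew gP brP e p q).
  by rewrite (gC p (levi_civita br g q e)); ring.
move=> p q r; rewrite [LHS]symE [RHS]symE !adeD !gE !frob; ring.
Qed.

Section Extension.
Variables (R : realType) (B : vectType R).
Variables (br circ star : B -> B -> B) (g : B -> B -> R).
Variables (mu lambda beta : R) (a0 b0 : B) (u D v : 'End(B)).
Hypothesis BP : weakly_flat_F_lie br circ g.
(* An opaque name for the Levi-Civita product: rewriting cannot unfold it. *)
Hypothesis starP : levi_civita br g =2 star.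
Hypothesis dataP : double_extension_data br circ g mu lambda a0 b0 u D v.

Let gP := wF_scalar BP.
Let gb := scalar_product_bilinear gP.
Let gC := scalar_product_sym gP.
Let gE := formE gb.
Let brP := wF_lie BP.
Let brb := lie_bilinear brP.
Let brE := bilinE brb.
Let circb := wF_bilinear BP.
Let circE := bilinE circb.
Let circC := wF_comm BP.
Let circA := wF_assoc BP.
Let frob := wF_frobenius BP.
Let starb : bilinear_product star.
Proof.
have [lcl lcr] := levi_civita_bilinear gP brP.
by split=> z c x y /=; rewrite -!starP; [apply: lcl | apply: lcr].
Qed.
Let starE := bilinE starb.
Let star_skew x y z : g (star x y) z = - g y (star x z).
Proof. by rewrite -!starP levi_civita_skew. Qed.
Let star_torsion x y : br x y = star x y - star y x.
Proof. by rewrite -!starP -levi_civita_torsion. Qed.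

Local Notation gT := (R^o * B * R^o)%type.
Local Notation form' := (ext_form g : gT -> gT -> R).
Local Notation star' := (ext_star star g mu b0 u D).
Local Notation br' := (ext_bracket star g mu b0 u D).
Local Notation circ' := (ext_circ circ g lambda beta a0 v).

Let tripleD (al al' : R) x y (de de' : R) :
  ((al, x, de) : gT) + ((al', y, de') : gT) = (al + al', x + y, de + de').
Proof. by []. Qed.
Let tripleN (al : R) x (de : R) : - ((al, x, de) : gT) = (- al, - x, - de).
Proof. by []. Qed.
Let tripleZ (c al : R) x (de : R) :
  c *: ((al, x, de) : gT) = (c * al, c *: x, c * de).
Proof. by []. Qed.
Let triple0 : 0 = (0, 0, 0) :> gT. Proof. by []. Qed.
Let tripleZD (c al al' : R) x y (de de' : R) :
  c *: ((al, x, de) : gT) + ((al', y, de') : gT) =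
  (c * al + al', c *: x + y, c * de + de').
Proof. by []. Qed.

Let triple_eq (al al' : R) (x y : B) (de de' : R) :
  al = al' -> (forall f : {scalar B}, f x = f y) -> de = de' ->
  (al, x, de) = (al', y, de') :> gT.
Proof. by move=> -> /eq_scalar -> ->. Qed.

Let endD (h : 'End(B)) x y : h (x + y) = h x + h y := linearD h x y.
Let endN (h : 'End(B)) x : h (- x) = - h x := linearN h x.
Let end0 (h : 'End(B)) : h 0 = 0 := linear0 h.
Let endZ (h : 'End(B)) c x : h (c *: x) = c *: h x := linearZ_LR h c x.
Let endE := (endD, endN, end0, endZ).
Let scalarE (f : {scalar B}) := (linearD f, linearN f, linear0 f, linearZ_LR f).
Let end_subE x : (D - u) x = D x - u x.
Proof. by rewrite add_lfunE opp_lfunE. Qed.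

Let circ_triple (al al' : R) x y (de de' : R) :
  circ' (al, x, de) (al', y, de') =
  (g (v x) y + lambda * (al * de' + de * al') + beta * de * de'
     + de * g a0 y + de' * g a0 x,
   circ x y + (de * de') *: a0 + de *: v y + de' *: v x,
   lambda * de * de').
Proof. by []. Qed.
Let star_triple (al al' : R) x y (de de' : R) :
  star' (al, x, de) (al', y, de') =
  (g (u x) y + mu * de * al' - de * g b0 y,
   star x y - de' *: u x + (de * de') *: b0 + de *: (D - u) y,
   - (mu * de * de')).
Proof. by []. Qed.

(** * Scalar product and Levi-Civita product of the extension *)

Lemma ext_form_scalar_product : scalar_product form'.
Proof.
split.
- by split; move=> [[? ?] ?] c [[? ?] ?] [[? ?] ?];
    rewrite !tripleZD /= !gE; ring.
- by move=> [[? ?] ?] [[? ?] ?]; rewrite /= gC; ring.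
- move=> [[al x] de] h; rewrite triple0.
  have := h (0, 0, 1); have := h (1, 0, 0).
  rewrite /= !gE !mulr0 !mulr1 !addr0 !add0r => -> ->.
  congr (_, _, _); apply: (scalar_product_nondegenerate gP) => y.
  by have := h (0, y, 0); rewrite /= !mulr0 addr0 add0r.
Qed.

Lemma ext_circ_bilinear : bilinear_product circ'.
Proof.
by split; move=> [[? ?] ?] c [[? ?] ?] [[? ?] ?];
  rewrite tripleZD !circ_triple tripleZD;
  apply: triple_eq => [|f|]; rewrite ?gE ?circE ?endE ?scalarE ?gE /=; ring.
Qed.

Lemma ext_star_bilinear : bilinear_product star'.
Proof.
by split; move=> [[? ?] ?] c [[? ?] ?] [[? ?] ?];
  rewrite tripleZD !star_triple tripleZD;
  apply: triple_eq => [|f|]; rewrite ?end_subE ?gE ?starE ?endE ?scalarE ?gE /=;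
  ring.
Qed.

Let v_self x y : g (v x) y = g x (v y).
Proof. by rewrite -(ext_v_selfadj dataP) adjoint_spec. Qed.

Let Du_skew x y : g ((D - u) x) y = - g x ((D - u) y).
Proof. by rewrite -adjoint_spec // (ext_Du_skew dataP) gE opprK. Qed.

(** The terms in [u x], [b0] and [mu] of the [a]-coefficient are balanced by those of the [B]- and
    [d]-components; what remains is skewness of [star] and of [D - u]. *)
Lemma ext_star_skew p q r : form' (star' p q) r = - form' q (star' p r).
Proof.
case: p q r => [[al x] de] [[al' y] de'] [[al'' z] de'']; rewrite !star_triple.
rewrite /= !gE (star_skew x y z) (Du_skew y z) (gC y (u x)) (gC y b0); ring.
Qed.

Lemma ext_star_left_symmetric : left_symmetric star'.
Proof.
have u_coc x y : u (star x y - star y x) = star x (u y) - star y (u x).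
  by rewrite -star_torsion (ext_u_cocycle dataP) !starP.
have Du_comm x : D (u x) - u (D x) = u (u x) - mu *: u x - star x b0.
  by rewrite (ext_Du_comm dataP) starP.
have Du_star x y :
    star x (u y) - u (star x y) = star (D x) y + star x (D y) - D (star x y).
  by rewrite -!starP (ext_Du_star dataP).
have flat x y z :
    star (star x y) z - star x (star y z) =
    star (star y x) z - star y (star x z).
  by have := wF_flat BP x y z; rewrite !starP.
move=> [[al x] de] [[al' y] de'] [[al'' z] de''].
rewrite !star_triple !tripleN !tripleD.
apply: triple_eq => [|f|]; last by ring.
(* The conditions on [u] and on [[D, u]], paired here with [z], return in the [B]-component with the
   factor [de''], since [star'] is skew. *)
- have hxy := congr1 (g^~ z) (u_coc x y).
  have hx := congr1 (fun t => de' * g t z) (Du_comm x).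
  have hy := congr1 (fun t => de * g t z) (Du_comm y).
  have sx := congr1 ( *%R de') (Du_skew (u x) z).
  have sy := congr1 ( *%R de) (Du_skew (u y) z).
  move: hxy hx hy sx sy.
  rewrite ?end_subE !gE !endE !gE (gC (u x) (star y z)) (gC (u y) (star x z)).
  rewrite !(star_skew _ z) !(gC z) (gC b0 (star x z)) (gC b0 (star y z)).
  rewrite !(star_skew _ z) !(gC z) (gC (u x) (u y)) (gC (u x) b0) (gC (u y) b0).
  lra.
- have hxyz := congr1 f (flat x y z).
  have hxy := congr1 (fun t => de'' * f t) (u_coc x y).
  have hx := congr1 (fun t => de' * f t) (Du_star x z).
  have hy := congr1 (fun t => de * f t) (Du_star y z).
  have hx' := congr1 (fun t => de'' * de' * f t) (Du_comm x).
  have hy' := congr1 (fun t => de'' * de * f t) (Du_comm y).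
  rewrite !scalarE in hxyz hxy hx hy hx' hy'.
  rewrite ?end_subE !endE !starE !scalarE.
  lra.
Qed.

Lemma ext_bracket_lie : lie_bracket br'.
Proof. exact: left_symmetric_lie ext_star_bilinear ext_star_left_symmetric. Qed.

Lemma ext_levi_civita : levi_civita br' form' =2 star'.
Proof.
exact: (levi_civita_unique ext_form_scalar_product ext_bracket_lie
  ext_star_skew (fun _ _ => erefl)).
Qed.

(** * The associative product of the extension *)

Let v_module := ext_v_module dataP.
Let v_square := ext_v_square dataP.

Lemma ext_circ_comm : commutative circ'.
Proof.
move=> [[al x] de] [[al' y] de']; rewrite !circ_triple.
apply: triple_eq => [|f|]; last by ring.
  by rewrite v_self gC; ring.
by rewrite (circC y) !scalarE; ring.
Qed.

Lemma ext_circ_frobenius p q r : form' (circ' p q) r = form' p (circ' q r).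
Proof.
case: p q r => [[al x] de] [[al' y] de'] [[al'' z] de''].
rewrite !circ_triple /= !gE !frob (gC x a0) !v_self; ring.
Qed.

Let vcr x y : circ x (v y) = circ (v x) y.
Proof. by rewrite circC -v_module circC v_module. Qed.

(** In [B], associativity on [(d, d, x)] is [v_square] and on [(d, x, y)] it is [v_module]; the
    [a]-coefficients follow from the Frobenius identity and self-adjointness of [v]. *)
Lemma ext_circ_assoc : associative circ'.
Proof.
move=> [[al x] de] [[al' y] de'] [[al'' z] de'']; rewrite !circ_triple.
apply: triple_eq => [|f|]; last by ring.
- rewrite !endE !gE -!v_self !v_square !gE ?v_module !(circC _ a0).
  by rewrite !frob (v_self x a0) (gC x (v a0)); ring.
- rewrite !endE !circE !v_square !vcr circA (circC a0 z) !v_module.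
  by rewrite !scalarE; ring.
Qed.

(* The elements of a^perp = Ra + B, which together with d spans gT. *)
Local Notation perp al x := ((al, x, 0) : gT).
Local Notation d := ((0, 0, 1) : gT).
Local Notation dd := ((beta, a0, lambda) : gT).

Let brC := lie_anticomm brP.
Let gu x y : g (adjoint g u x) y = g x (u y).
Proof. exact: adjoint_spec. Qed.
Let gD x y : g (adjoint g D x) y = g x (D y).
Proof. exact: adjoint_spec. Qed.
Let gad x y z : g (adjoint g (br x) y) z = g y (br x z).
Proof. by apply: adjoint_linear => // c p q; rewrite !brE. Qed.

(** The [d]-coefficient of [star'] is symmetric, so brackets lie in [a^perp]. The general second
    argument covers [dd], the square of [d]. *)
Let bracket_perp al al' x y (de : R) :
  br' (al, x, 0) (al', y, de) =
  (g (u x) y - g x (u y) - mu * al * de + de * g b0 x, br x y - de *: D x, 0).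
Proof.
rewrite /ext_bracket !star_triple tripleN tripleD.
apply: triple_eq => [|f|]; last by ring.
- by rewrite (gC x); ring.
- by rewrite !end_subE star_torsion ?endE !scalarE; ring.
Qed.

Let bracket_perps al al' x y :
  br' (perp al x) (perp al' y) = perp (g (u x) y - g x (u y)) (br x y).
Proof.
rewrite bracket_perp; apply: triple_eq => [|f|] //; first by ring.
by rewrite !scalarE; ring.
Qed.

Let bracket_perp_d al x :
  br' (perp al x) d = perp (g b0 x - mu * al) (- D x).
Proof.
rewrite bracket_perp; apply: triple_eq => [|f|] //.
  by rewrite ?endE !gE; ring.
by rewrite !brE !scalarE; ring.
Qed.

Let bracket_d al y (de : R) :
  br' d (al, y, de) = perp (mu * al - g b0 y) (D y).
Proof.
rewrite /ext_bracket !star_triple tripleN tripleD.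
apply: triple_eq => [|f|]; last by ring.
- by rewrite ?endE !gE; ring.
- rewrite ?end_subE ?starE ?endE !scalarE; ring.
Qed.

Let circ_perp al al' x y (de : R) :
  circ' (perp al x) (al', y, de) =
  perp (g (v x) y + lambda * al * de + de * g a0 x) (circ x y + de *: v x).
Proof.
rewrite !circ_triple; apply: triple_eq => [|f|]; [ring | | ring].
by rewrite !scalarE; ring.
Qed.

Let circ_perps al al' x y :
  circ' (perp al x) (perp al' y) = perp (g (v x) y) (circ x y).
Proof.
rewrite circ_perp; apply: triple_eq => [|f|] //; first by ring.
by rewrite !scalarE; ring.
Qed.

Let circ_perp_d al x :
  circ' (perp al x) d = perp (lambda * al + g a0 x) (v x).
Proof.
rewrite circ_perp; apply: triple_eq => [|f|] //.
  by rewrite !gE; ring.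
by rewrite !circE !scalarE; ring.
Qed.

Let circ_d_perp al x :
  circ' d (perp al x) = perp (lambda * al + g a0 x) (v x).
Proof. by rewrite ext_circ_comm circ_perp_d. Qed.

Let circ_d_d : circ' d d = dd.
Proof.
rewrite circ_triple; apply: triple_eq => [|f|]; rewrite ?endE ?circE ?gE.
- ring.
- by rewrite !scalarE; ring.
- ring.
Qed.

Let triple0P (p : gT) :
  p.1.1 = 0 -> (forall f : {scalar B}, f p.1.2 = 0) -> p.2 = 0 -> p = 0.
Proof.
case: p => [[al x] de] /= p1 p2 p3; apply: triple_eq => // f.
by rewrite p2 linear0.
Qed.

(** The special bracket formulas precede the general [bracket_perp], so that they are tried
    first. *)
Let tableE := ((circ_perps, circ_perp_d, circ_d_perp, circ_d_d),
  (bracket_perps, bracket_perp_d, bracket_perp, bracket_d)).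

(** * The five values of the Hertling-Manin relation *)

Lemma ext_hm_xyzt al1 al2 al3 al4 x y z t :
  hm_defect br' circ' (perp al1 x) (perp al2 y) (perp al3 z) (perp al4 t) = 0.
Proof.
rewrite /hm_defect !tableE; apply: triple0P => [|f|] /=; last by ring.
- have h := congr1 (g^~ t) (ext_w_circ_circ dataP x y z).
  rewrite !endE !circE !gE !v_module !vcr !frob !gad !gu !frob in h.
  rewrite (v_self (br (circ x y) t)) (gC (br _ t) (v z)) !v_module !frob.
  rewrite (circC (br y t)) (circC (br x t)); lra.
- by rewrite (wF_hertling_manin BP x y z t) linear0.
Qed.

Lemma ext_hm_xydd al1 al2 x y :
  hm_defect br' circ' (perp al1 x) (perp al2 y) d d = 0.
Proof.
rewrite /hm_defect !tableE; apply: triple0P => [|f|] /=; last by ring.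
- have h := congr1 (g^~ y) (ext_v_D dataP x).
  rewrite !circE !(circC x) (circC (D x) a0) !gE !frob !gu !gD !gad in h.
  rewrite (circC (D x)) (frob a0 x) (v_self (br a0 x)) (v_self (D x)) in h.
  rewrite (gC (br a0 x)) (gC (D x)) in h.
  rewrite !circE !gE (brC y a0) (brC x a0) !gE.
  by rewrite (gC (u (circ x y))) (gC (circ x y) (u a0)); lra.
- have h := congr1 f (ext_a0_circ dataP x y).
  by rewrite !endE !scalarE in h; rewrite !circE !endE !scalarE; lra.
Qed.

(** By [hm_defect_swap] this value is antisymmetric in the two vectors of [a^perp]; accordingly
    [ext_skew] involves a skew operator and [ext_v_bracket] an alternating map. *)
Lemma ext_hm_xdyd al1 al2 x y :
  hm_defect br' circ' (perp al1 x) d (perp al2 y) d = 0.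
Proof.
rewrite /hm_defect !tableE; apply: triple0P => [|f|] /=; last by ring.
- have h := congr1 (g^~ y) (ext_skew dataP x).
  rewrite !endE (circC x) !gE !v_self !frob !gu !gD !gad !v_self (frob a0) in h.
  by rewrite ?endE ?gE !v_self v_square (circC y) (bilin0r circb) !gE; lra.
- have h := congr1 f (ext_v_bracket dataP x y).
  rewrite !endE !scalarE in h.
  rewrite !endE !circE ?endE !scalarE (brC x (v y)) (circC x (D (v y))).
  by rewrite -(v_module (D x)) (circC (D x) y) !endE !scalarE; lra.
Qed.

Lemma ext_hm_xddd al x :
  hm_defect br' circ' (perp al x) d d d = 0.
Proof.
rewrite /hm_defect !tableE; apply: triple0P => [|f|] /=; last by ring.
- have h := congr1 (g^~ x) (ext_a0 dataP).
  rewrite !endE !gE !v_self !gu !gD !gad !v_self in h.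
  rewrite (brC x) !endE !gE (gC (u (v x))) (gC (v x) (u a0)) (gC (v x) (D a0)).
  by rewrite (gC (u x)) (gC x (u a0)) (bilin0r circb) !gE; lra.
- have h := congr1 f (ext_ad_v dataP x).
  rewrite !scalarE in h.
  by rewrite (brC (v x)) (brC x) !endE !(bilin0r circb) !endE !scalarE; lra.
Qed.

Lemma ext_hm_xyzd al1 al2 al3 x y z :
  hm_defect br' circ' (perp al1 x) (perp al2 y) (perp al3 z) d = 0.
Proof.
rewrite /hm_defect !tableE; apply: triple0P => [|f|] /=; last by ring.
- have h := congr1 (g^~ z) (ext_w_circ dataP x y).
  rewrite ?endE ?gE ?v_self ?gu ?gad ?frob ?v_self in h.
  by rewrite ?circE !endE !gE !v_self !frob; lra.
- have h := congr1 f (ext_circ_v dataP x y z).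
  by rewrite ?endE !scalarE in h; rewrite ?circE ?endE !scalarE; lra.
Qed.

Lemma ext_weakly_flat : weakly_flat_F_lie br' circ' form'.
Proof.
split.
- exact: ext_bracket_lie.
- exact: ext_form_scalar_product.
- by move=> p q r; rewrite !ext_levi_civita; apply: ext_star_left_symmetric.
- exact: ext_circ_bilinear.
- exact: ext_circ_assoc.
- exact: ext_circ_comm.
- exact: ext_circ_frobenius.
- have perpP (p : gT) : p.2 = 0 -> p = perp p.1.1 p.1.2.
    by case: p => [[? ?] ?] /= ->.
  apply: (@hertling_manin_of_hyperplane _ _ _ _ ext_bracket_lie
    ext_circ_bilinear ext_circ_comm ext_circ_assoc (fun p => p.2 = 0) d).
  + by move=> [[al x] de]; exists de; rewrite tripleZ mulr1 /= subrr.
  + move=> p q r s /perpP-> /perpP-> /perpP-> /perpP->.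
    exact: ext_hm_xyzt.
  + move=> p q r /perpP-> /perpP-> /perpP->; exact: ext_hm_xyzd.
  + move=> p q /perpP-> /perpP->; exact: ext_hm_xydd.
  + move=> p q /perpP-> /perpP->; exact: ext_hm_xdyd.
  + move=> p /perpP->; exact: ext_hm_xddd.
Qed.

(** * The unit and its flatness *)

Variable ebar : B.
Hypothesis unitP : unit_data br circ g lambda a0 b0 ebar u D v.
Local Notation e := (ext_unit g lambda beta a0 ebar).

Let lambda_neq0 : lambda != 0 := unit_lambda unitP.

(** The [a]-coefficient of [e] is the one that cancels the contributions of [beta] and [g a0 ebar]
    when [e] multiplies [d]. *)
Lemma ext_unit_circ p : circ' e p = p.
Proof.
case: p => [[al x] de]; rewrite circ_triple; apply: triple_eq => [|f|].
- rewrite (unit_v unitP) !gE; field; exact: lambda_neq0.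
- rewrite -[in RHS](unit_circ unitP x) (unit_v unitP) (circC x) !scalarE.
  by field.
- by rewrite divff // mul1r.
Qed.

(** The unit equations give [u] as [lambda] times right multiplication by [ebar], and [b0] as
    [- lambda *: (D - u) ebar]. The [B]-component then cancels, and skewness removes the pairings
    with [ebar], leaving only terms in [mu * de]. *)
Lemma star_ext_unit al x de :
  star' (al, x, de) e =
  (mu * de * - (g a0 ebar / lambda + beta / lambda ^+ 2), 0,
   - (mu * de / lambda)).
Proof.
have skew y : g (star y ebar) ebar = 0.
  by have := star_skew y ebar ebar; rewrite (gC ebar); lra.
have uE y : u y = lambda *: star y ebar.
  have := unit_star unitP y; rewrite starP => /eqP; rewrite subr_eq0 => /eqP ->.
  by rewrite scalerA divff ?scale1r.
have b0E : b0 = - lambda *: (D - u) ebar.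
  by rewrite (unit_Du unitP) scalerA mulrNN divff ?scale1r.
have Dskew : g ((D - u) ebar) ebar = 0.
  by have := Du_skew ebar ebar; rewrite (gC ebar); lra.
rewrite star_triple; apply: triple_eq => [|f|] //.
- by rewrite uE b0E !gE skew // Dskew; ring.
- rewrite uE b0E !scalarE; field; exact: lambda_neq0.
Qed.

Lemma ext_mu_eq0 x : v x != 0 -> mu = 0.
Proof.
move=> vx; apply: contraNeq vx => mu0; apply/eqP.
apply: (scalar_product_nondegenerate gP) => y.
(* Only the pairing of [d * e] with the product of [x] and [y] survives: the [d]-coefficient
   [- (mu / lambda)] meets the [a]-coefficient [g (v x) y]. *)
have := weakly_flat_unit_symmetric ext_weakly_flat ext_unit_circ d
  (perp 0 x) (perp 0 y).
rewrite !ext_levi_civita !tableE !star_ext_unit /= !gE.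
rewrite !(mulr0, mul0r, addr0, add0r, oppr0) mulr1 => /esym/eqP.
by rewrite mulNr oppr_eq0 !mulf_eq0 invr_eq0 (negPf mu0) (negPf lambda_neq0)
  => /eqP.
Qed.

Lemma ext_flat : mu = 0 -> flat_F_lie br' circ' form' e.
Proof.
move=> mu0; split; [exact: ext_weakly_flat | exact: ext_unit_circ |].
move=> [[al x] de]; rewrite ext_levi_civita star_ext_unit mu0.
by rewrite !mul0r oppr0.
Qed.

End Extension.

Theorem theorem3p9 (R : realType) (B : vectType R)
    (br circ : B -> B -> B) (g : B -> B -> R)
    (mu lambda beta : R) (a0 b0 ebar : B) (u D v : 'End(B)) :
  weakly_flat_F_lie br circ g ->
  double_extension_data br circ g mu lambda a0 b0 u D v ->
  let star' := ext_star (levi_civita br g) g mu b0 u D in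
  let br' := ext_bracket (levi_civita br g) g mu b0 u D in
  let circ' := ext_circ circ g lambda beta a0 v in
  let g' := ext_form g in
  [/\ levi_civita br' g' =2 star',
      weakly_flat_F_lie br' circ' g'
    & unit_data br circ g lambda a0 b0 ebar u D v ->
      ((exists x, v x != 0) -> mu = 0) /\
      (mu = 0 -> flat_F_lie br' circ' g' (ext_unit g lambda beta a0 ebar))].
Proof.
move=> BP dataP star' br' circ' g'.
have starP : levi_civita br g =2 levi_civita br g by [].
split.
- exact: (ext_levi_civita BP starP dataP).
- exact: (ext_weakly_flat beta BP starP dataP).
- move=> unitP; split; last exact: (ext_flat beta BP starP dataP unitP).
  by case=> x; apply: (ext_mu_eq0 beta BP starP dataP unitP).
Qed.
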